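(* Let $k,m>0$ and consider the Sturm-Liouville problem in Liouville normal form $$\text{(N)}\qquad -\frac{d^2v}{dt^2}+\frac{k}{(t+m)^2}v=\lambda v,\quad 0<t<\pi,\qquad v(0)=0=v(\pi).$$ For the particular case in which the transformation function $w$ of the dependent variable ($u=wv$) is reciprocal linear in $t$ (that is, $1/w$ is a linear function of $t$), (N) can be transformed to a canonical form preserving the type of the boundary conditions (Dirichlet): for all constants $C_1>0$ and $x_0\in\mathbb R$, it is given by $$-\frac d{dx}\left[\frac18C_1^3(x+x_0)^3\frac{du}{dx}\right]+\frac k2C_1^3(x+x_0)\,u=\lambda\left[\frac12C_1(x+x_0)\right]^5u,\qquad a<x<b,$$ with $u(a)=0=u(b)$, where $$a=-x_0+2\sqrt{\frac m{C_1}},\qquad b=-x_0+2\sqrt{\frac{\pi+m}{C_1}},\qquad \delta_0=(C_1m)^2,\qquad \gamma_0=C_1^2(\pi+m)^2.$$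
   Context: A canonical form is a problem $-(p\,u')'+q\,u=\lambda r\,u$ on $a<x<b$ with boundary conditions $\delta_0u(a)-\delta_1p(a)u'(a)=0$, $\gamma_0u(b)-\gamma_1p(b)u'(b)=0$; here $\delta_1=\gamma_1=0$. We say that (N) can be transformed to this canonical form if the two are related by Liouville's transformation: there is an increasing bijection $t\mapsto x(t)$ from $[0,\pi]$ onto $[a,b]$ with $dx/dt=\sqrt{p/r}$, and with $w=(pr)^{-1/4}$ one has $$\frac{k}{(t+m)^2}=\frac qr+w\frac{d^2}{dt^2}\left(\frac1w\right),$$ so that $u=wv$ turns (N), for every $\lambda$, into the canonical problem. The boundary coefficients are normalized by $\delta_0=1/w^2$ at $x=a$ and $\gamma_0=1/w^2$ at $x=b$. *)

(* Defs.v *)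
From Stdlib Require Export Reals.
From Coquelicot Require Export Coquelicot.
Open Scope R_scope.

(** The Sturm-Liouville problem [-(p u')' + q u = lambda r u] on [a < x < b],
    with boundary conditions [delta0 u(a) - delta1 (p u')(a) = 0] and
    [gamma0 u(b) - gamma1 (p u')(b) = 0]. *)
Record SL_problem := mk_SL {
  coef_p : R -> R;
  coef_q : R -> R;
  coef_r : R -> R;
  left_end : R;
  right_end : R;
  delta0 : R;
  delta1 : R;
  gamma0 : R;
  gamma1 : R
}.

Definition quasi_derivative (P : SL_problem) (u : R -> R) (x : R) : R :=
  coef_p P x * Derive u x.

(** Classical solutions. Only the values of [u] on [[a,b]] matter; the boundary
    values of [p u'] are its one-sided limits at the endpoints. *)
Definition is_solution (P : SL_problem) (lambda : R) (u : R -> R) : Prop :=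
  continuous_on (fun x => left_end P <= x <= right_end P) u /\
  (forall x, left_end P < x < right_end P ->
     ex_derive u x /\
     ex_derive (quasi_derivative P u) x /\
     - Derive (quasi_derivative P u) x + coef_q P x * u x
       = lambda * coef_r P x * u x) /\
  (exists ya yb : R,
     filterlim (quasi_derivative P u) (at_right (left_end P)) (locally ya) /\
     filterlim (quasi_derivative P u) (at_left (right_end P)) (locally yb) /\
     delta0 P * u (left_end P) - delta1 P * ya = 0 /\
     gamma0 P * u (right_end P) - gamma1 P * yb = 0).

(** [-v'' + Q v = lambda v] on [0 < t < PI], [v(0) = 0 = v(PI)]. *)
Definition normal_form (Q : R -> R) : SL_problem :=
  {| coef_p := fun _ => 1;
     coef_q := Q;
     coef_r := fun _ => 1;
     left_end := 0;
     right_end := PI;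
     delta0 := 1;
     delta1 := 0;
     gamma0 := 1;
     gamma1 := 0 |}.

(** [w = (p r)^(-1/4)], as a function of [x]; as a function of [t] it is
    [fun t => liouville_w P (X t)]. *)
Definition liouville_w (P : SL_problem) (x : R) : R :=
  Rpower (coef_p P x * coef_r P x) (- (1 / 4)).

Definition increasing_bijection (c d a b : R) (X : R -> R) : Prop :=
  (forall t, c <= t <= d -> a <= X t <= b) /\
  (forall s t, c <= s -> s < t -> t <= d -> X s < X t) /\
  (forall x, a <= x <= b -> exists t, c <= t <= d /\ X t = x).

(** [t |-> X t] is the change of independent variable of a Liouville
    transformation between [normal_form Q] and [P]. *)
Definition liouville_transformation
    (Q : R -> R) (P : SL_problem) (X : R -> R) : Prop :=
  let W := fun t => liouville_w P (X t) in
  left_end P < right_end P /\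
  (forall x, left_end P <= x <= right_end P -> 0 < coef_p P x /\ 0 < coef_r P x) /\
  increasing_bijection 0 PI (left_end P) (right_end P) X /\
  (forall t, 0 < t < PI ->
     is_derive X t (sqrt (coef_p P (X t) / coef_r P (X t)))) /\
  (forall t, 0 < t < PI ->
     ex_derive (fun s => / W s) t /\
     ex_derive_n (fun s => / W s) 2 t /\
     Q t = coef_q P (X t) / coef_r P (X t)
           + W t * Derive_n (fun s => / W s) 2 t) /\
  (forall (lambda : R) (u v : R -> R),
     (forall t, 0 <= t <= PI -> u (X t) = W t * v t) ->
     (is_solution (normal_form Q) lambda v <-> is_solution P lambda u)).

Definition boundary_normalized (P : SL_problem) : Prop :=
  delta0 P = 1 / liouville_w P (left_end P) ^ 2 /\
  gamma0 P = 1 / liouville_w P (right_end P) ^ 2.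

Definition reciprocal_linear (W : R -> R) : Prop :=
  exists alpha beta : R, alpha <> 0 /\
    forall t, 0 <= t <= PI -> 1 / W t = alpha * t + beta.

(* Main.v *)
(** The substitution is [C1 (x + x0)^2 = 4 (t + m)]; it gives
    [p r = (C1 (t + m))^4], so [1/w = C1 (t + m)] is linear and the term
    [w (1/w)''] vanishes. For the correspondence of solutions, the
    quasi-derivative of [u x = g x * v (phi x)] is a combination
    [alpha * (p v')(phi) + beta * v(phi)] with smooth coefficients, so one-sided
    limits at the endpoints carry over along with the equation; the same
    argument applies to the inverse substitution. *)
Require Import Defs.
From Stdlib Require Import Reals Lra Psatz.
From Coquelicot Require Import Coquelicot.
Open Scope R_scope.

(** * Relative and one-sided limits *)

(** Used to compose limits taken relative to a set: a change of variable that stays inside the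
    target interval converges there in the relative sense, hence also one-sidedly at an endpoint. *)
Lemma filterlim_to_within {U V : Type} (F : (U -> Prop) -> Prop) {FF : Filter F}
    (G : (V -> Prop) -> Prop) (D : V -> Prop) (f : U -> V) :
  filterlim f F G -> F (fun x => D (f x)) -> filterlim f F (within D G).
Proof.
intros Hf HD A HA.
specialize (Hf _ HA).
unfold filtermap in *.
generalize (filter_and _ _ Hf HD); apply filter_imp.
intros x [H1 H2]; exact (H1 H2).
Qed.

Lemma filterlim_from_within (D : R -> Prop) (f : R -> R) (x y : R) :
  continuous f x -> f x = y -> filterlim f (within D (locally x)) (locally y).
Proof.
intros Hf <-.
apply filterlim_filter_le_1 with (2 := Hf).
apply filter_le_within.
Qed.

Lemma at_right_lt (a b : R) : a < b -> at_right a (fun x => a < x < b).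
Proof.
intros Hab.
unfold at_right, within.
generalize (open_lt b a Hab); apply filter_imp.
intros x H1 H2; split; assumption.
Qed.

Lemma at_left_lt (a b : R) : a < b -> at_left b (fun x => a < x < b).
Proof.
intros Hab.
unfold at_left, within.
generalize (open_gt a b Hab); apply filter_imp.
intros x H1 H2; split; assumption.
Qed.

Lemma open_interval_locally (a b x : R) :
  a < x < b -> locally x (fun y => a < y < b).
Proof.
intros [H1 H2].
apply filter_and; [exact (open_gt a x H1) | exact (open_lt b x H2)].
Qed.

(** A solution is continuous only relative to the closed interval. Points to the right of [a] and
    below [b] lie in that interval, which is enough for a one-sided limit. *)
Lemma continuous_on_at_right (a b : R) (f : R -> R) :
  a < b -> continuous_on (fun x => a <= x <= b) f ->
  filterlim f (at_right a) (locally (f a)).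
Proof.
intros Hab Hf A HA.
assert (Ha : a <= a <= b) by lra.
specialize (Hf a Ha A HA).
unfold filtermap, at_right, within in *.
generalize (filter_and _ _ Hf (open_lt b a Hab)); apply filter_imp.
intros x [H1 H2] H3; apply H1; lra.
Qed.

Lemma continuous_on_at_left (a b : R) (f : R -> R) :
  a < b -> continuous_on (fun x => a <= x <= b) f ->
  filterlim f (at_left b) (locally (f b)).
Proof.
intros Hab Hf A HA.
assert (Hb : a <= b <= b) by lra.
specialize (Hf b Hb A HA).
unfold filtermap, at_left, within in *.
generalize (filter_and _ _ Hf (open_gt a b Hab)); apply filter_imp.
intros x [H1 H2] H3; apply H1; lra.
Qed.

Lemma filterlim_Rmult {T : Type} (F : (T -> Prop) -> Prop) {FF : Filter F}
    (f g : T -> R) (a b : R) :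
  filterlim f F (locally a) -> filterlim g F (locally b) ->
  filterlim (fun x => f x * g x) F (locally (a * b)).
Proof.
intros Hf Hg.
exact (filterlim_comp_2 _ _ mult Hf Hg (filterlim_mult a b)).
Qed.

Lemma filterlim_combination {T : Type} (F : (T -> Prop) -> Prop) {FF : Filter F}
    (f1 g1 f2 g2 : T -> R) (a1 b1 a2 b2 : R) :
  filterlim f1 F (locally a1) -> filterlim g1 F (locally b1) ->
  filterlim f2 F (locally a2) -> filterlim g2 F (locally b2) ->
  filterlim (fun x => f1 x * g1 x + f2 x * g2 x) F (locally (a1 * b1 + a2 * b2)).
Proof.
intros H1 H2 H3 H4.
exact (filterlim_comp_2 _ _ plus
         (filterlim_Rmult F _ _ _ _ H1 H2) (filterlim_Rmult F _ _ _ _ H3 H4)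
         (filterlim_plus (a1 * b1) (a2 * b2))).
Qed.

(** * Transfer of solutions under a change of variables *)

(** The hypotheses on [alpha] and [beta] say that
    [(p2 u', u) = (alpha (p1 v')(phi) + beta v(phi), g v(phi))] maps the
    first-order system of [P1] to that of [P2]. *)
Lemma dirichlet_solution_transfer (P1 P2 : SL_problem)
    (phi dphi g dg alpha dalpha beta dbeta : R -> R) (lambda : R) (u v : R -> R) :
  let I := fun x => left_end P2 <= x <= right_end P2 in
  left_end P1 < right_end P1 -> left_end P2 < right_end P2 ->
  delta1 P1 = 0 -> gamma1 P1 = 0 -> delta0 P1 <> 0 -> gamma0 P1 <> 0 ->
  delta1 P2 = 0 -> gamma1 P2 = 0 ->
  phi (left_end P2) = left_end P1 -> phi (right_end P2) = right_end P1 ->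
  (forall x, left_end P2 < x < right_end P2 ->
     left_end P1 < phi x < right_end P1) ->
  (forall x, I x -> is_derive phi x (dphi x)) ->
  (forall x, I x -> is_derive g x (dg x)) ->
  (forall x, I x -> is_derive alpha x (dalpha x)) ->
  (forall x, I x -> is_derive beta x (dbeta x)) ->
  (forall x, I x -> coef_p P2 x * g x * dphi x = alpha x * coef_p P1 (phi x)) ->
  (forall x, I x -> coef_p P2 x * dg x = beta x) ->
  (forall x, I x -> dalpha x * coef_p P1 (phi x) + beta x * dphi x = 0) ->
  (forall x, I x ->
     alpha x * dphi x * coef_q P1 (phi x) + dbeta x = coef_q P2 x * g x) ->
  (forall x, I x -> alpha x * dphi x * coef_r P1 (phi x) = coef_r P2 x * g x) ->
  (forall x, I x -> u x = g x * v (phi x)) ->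
  is_solution P1 lambda v -> is_solution P2 lambda u.
Proof.
intros I H1 H2 Hd1 Hg1 Hd0 Hg0 Hd2 Hg2 Hl Hr Hphi Dphi Dg Da Db Ea Eb E1 Eq Er Hu.
intros (Cv & Sv & ya & yb & La & Lb & Ba & Bb).
set (l1 := left_end P1) in *; set (r1 := right_end P1) in *.
set (l2 := left_end P2) in *; set (r2 := right_end P2) in *.
assert (Il : I l2) by (unfold I; lra).
assert (Ir : I r2) by (unfold I; lra).
assert (cont : forall (f : R -> R) (df x : R), is_derive f x df -> continuous f x).
{ intros f df x H; apply (ex_derive_continuous f x); exists df; exact H. }
assert (Iphi : forall x, I x -> l1 <= phi x <= r1).
{ intros x [[Hx | <-] [Hx' | ->]]; try lra.
  specialize (Hphi x (conj Hx Hx')); lra. }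
assert (Du : forall x, l2 < x < r2 ->
  is_derive u x (dg x * v (phi x) + g x * (dphi x * Derive v (phi x)))).
{ intros x Hx.
  (* [u] is prescribed only on the closed interval, so the product is differentiated at interior
     points, where the two functions agree on a neighbourhood. *)
  apply is_derive_ext_loc with (fun y => g y * v (phi y)).
  - generalize (open_interval_locally _ _ _ Hx); apply filter_imp.
    intros y Hy; symmetry; apply Hu; unfold I; lra.
  - apply (is_derive_mult g (fun y => v (phi y)) x); [ | | apply Rmult_comm].
    + apply Dg; unfold I; lra.
    + apply (is_derive_comp v phi x).
      * apply Derive_correct; apply (Sv (phi x)); auto.
      * apply Dphi; unfold I; lra. }
(* In this form the quasi-derivative of [u] is differentiated through that of [v], so neither a
   second derivative of [v] nor a derivative of [coef_p] appears. *)
assert (Qu : forall x, l2 < x < r2 ->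
  quasi_derivative P2 u x
  = alpha x * quasi_derivative P1 v (phi x) + beta x * v (phi x)).
{ intros x Hx.
  assert (Ix : I x) by (unfold I; lra).
  unfold quasi_derivative.
  rewrite (is_derive_unique _ _ _ (Du x Hx)), <- (Eb x Ix).
  transitivity (coef_p P2 x * g x * dphi x * Derive v (phi x)
                + coef_p P2 x * dg x * v (phi x)); [ring|].
  rewrite (Ea x Ix); ring. }
split; [ | split].
- intros x Ix.
  rewrite (Hu x Ix).
  apply filterlim_within_ext with (fun y => g y * v (phi y)).
  { intros y Iy; symmetry; exact (Hu y Iy). }
  apply filterlim_Rmult; [typeclasses eauto | | ].
  + apply filterlim_from_within; [exact (cont _ _ _ (Dg x Ix)) | reflexivity].
  + refine (filterlim_comp _ _ _ phi v _ _ _ _ (Cv (phi x) (Iphi x Ix))).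
    apply filterlim_to_within; [typeclasses eauto | | ].
    * apply filterlim_from_within; [exact (cont _ _ _ (Dphi x Ix)) | reflexivity].
    * unfold within; apply filter_forall; intros y Iy; exact (Iphi y Iy).
- fold l2 r2; intros x Hx.
  assert (Ix : I x) by (unfold I; lra).
  destruct (Sv (phi x) (Hphi x Hx)) as (Ev & EQ & Eqn).
  assert (DQ : is_derive (quasi_derivative P2 u) x
    ((dalpha x * quasi_derivative P1 v (phi x)
      + alpha x * (dphi x * Derive (quasi_derivative P1 v) (phi x)))
     + (dbeta x * v (phi x) + beta x * (dphi x * Derive v (phi x))))).
  { apply is_derive_ext_loc with
      (fun y => alpha y * quasi_derivative P1 v (phi y) + beta y * v (phi y)).
    - generalize (open_interval_locally _ _ _ Hx); apply filter_imp.
      intros y Hy; symmetry; exact (Qu y Hy).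
    - apply (is_derive_plus (fun y => alpha y * quasi_derivative P1 v (phi y))
               (fun y => beta y * v (phi y)) x).
      + apply (is_derive_mult alpha (fun y => quasi_derivative P1 v (phi y)) x);
          [exact (Da x Ix) | | apply Rmult_comm].
        apply (is_derive_comp (quasi_derivative P1 v) phi x);
          [apply Derive_correct; exact EQ | exact (Dphi x Ix)].
      + apply (is_derive_mult beta (fun y => v (phi y)) x);
          [exact (Db x Ix) | | apply Rmult_comm].
        apply (is_derive_comp v phi x);
          [apply Derive_correct; exact Ev | exact (Dphi x Ix)]. }
  split; [eexists; exact (Du x Hx) | split; [eexists; exact DQ | ]].
  rewrite (is_derive_unique _ _ _ DQ), (Hu x Ix).
  unfold quasi_derivative at 1.
  (* The equation for [v] at [phi x], solved for its highest-order term. *)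
  assert (EQ' : Derive (quasi_derivative P1 v) (phi x)
    = (coef_q P1 (phi x) - lambda * coef_r P1 (phi x)) * v (phi x)) by lra.
  rewrite EQ'.
  (* Terms are grouped by [v'], [v] and [lambda * v] at [phi x]. By [E1] and [Eq] the first two
     groups vanish, and by [Er] the third is the required right-hand side. *)
  transitivity
    (- (dalpha x * coef_p P1 (phi x) + beta x * dphi x) * Derive v (phi x)
     + (coef_q P2 x * g x
        - (alpha x * dphi x * coef_q P1 (phi x) + dbeta x)) * v (phi x)
     + lambda * (alpha x * dphi x * coef_r P1 (phi x)) * v (phi x)); [ring|].
  rewrite (E1 x Ix), (Eq x Ix), (Er x Ix); ring.
- rewrite Hd1 in Ba; rewrite Hg1 in Bb; rewrite Hd2, Hg2.
  fold l2 r2; rewrite (Hu l2 Il), (Hu r2 Ir), Hl, Hr.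
  (* Both boundary conditions are Dirichlet with a nonzero coefficient, so [v] vanishes at both
     endpoints. *)
  assert (Va : v l1 = 0) by (apply Rmult_eq_reg_l with (delta0 P1); [fold l1 in Ba; lra | exact Hd0]).
  assert (Vb : v r1 = 0) by (apply Rmult_eq_reg_l with (gamma0 P1); [fold r1 in Bb; lra | exact Hg0]).
  exists (alpha l2 * ya + beta l2 * v l1), (alpha r2 * yb + beta r2 * v r1).
  (* Only the value in the boundary condition is replaced by zero; the one inside the limit keeps
     the shape produced by [filterlim_combination]. *)
  rewrite Va at 2; rewrite Vb at 2.
  split; [ | split; [ | split; ring]].
  + apply (filterlim_ext_loc
      (fun y => alpha y * quasi_derivative P1 v (phi y) + beta y * v (phi y))).
    { generalize (at_right_lt _ _ H2); apply filter_imp.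
      intros y Hy; symmetry; exact (Qu y Hy). }
    (* Since [phi] maps the open interval into the open interval, it approaches the endpoint from
       the same side. *)
    assert (Lphi : filterlim phi (at_right l2) (at_right l1)).
    { apply filterlim_to_within; [typeclasses eauto | | ].
      - apply filterlim_from_within; [exact (cont _ _ _ (Dphi l2 Il)) | exact Hl].
      - generalize (at_right_lt _ _ H2); apply filter_imp.
        intros y Hy; apply Hphi, Hy. }
    apply filterlim_combination; [typeclasses eauto | | | | ].
    * apply filterlim_from_within; [exact (cont _ _ _ (Da l2 Il)) | reflexivity].
    * exact (filterlim_comp _ _ _ _ _ _ _ _ Lphi La).
    * apply filterlim_from_within; [exact (cont _ _ _ (Db l2 Il)) | reflexivity].
    * exact (filterlim_comp _ _ _ _ _ _ _ _ Lphi (continuous_on_at_right _ _ _ H1 Cv)).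
  + apply (filterlim_ext_loc
      (fun y => alpha y * quasi_derivative P1 v (phi y) + beta y * v (phi y))).
    { generalize (at_left_lt _ _ H2); apply filter_imp.
      intros y Hy; symmetry; exact (Qu y Hy). }
    assert (Lphi : filterlim phi (at_left r2) (at_left r1)).
    { apply filterlim_to_within; [typeclasses eauto | | ].
      - apply filterlim_from_within; [exact (cont _ _ _ (Dphi r2 Ir)) | exact Hr].
      - generalize (at_left_lt _ _ H2); apply filter_imp.
        intros y Hy; apply Hphi, Hy. }
    apply filterlim_combination; [typeclasses eauto | | | | ].
    * apply filterlim_from_within; [exact (cont _ _ _ (Da r2 Ir)) | reflexivity].
    * exact (filterlim_comp _ _ _ _ _ _ _ _ Lphi Lb).
    * apply filterlim_from_within; [exact (cont _ _ _ (Db r2 Ir)) | reflexivity].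
    * exact (filterlim_comp _ _ _ _ _ _ _ _ Lphi (continuous_on_at_left _ _ _ H1 Cv)).
Qed.

(** * The explicit reciprocal linear transformation *)

Lemma Rpower_pow4_neg_quarter (z : R) : 0 < z -> Rpower (z ^ 4) (- (1 / 4)) = / z.
Proof.
intros Hz.
rewrite <- Rpower_pow, Rpower_mult by exact Hz.
replace (INR 4 * - (1 / 4)) with (Ropp 1) by (simpl; field).
rewrite Rpower_Ropp, Rpower_1 by exact Hz; reflexivity.
Qed.

Theorem theorem11 (k m : R) (hk : 0 < k) (hm : 0 < m)
    (C1 x0 : R) (hC1 : 0 < C1) :
  let P :=
    {| coef_p := fun x => 1 / 8 * C1 ^ 3 * (x + x0) ^ 3;
       coef_q := fun x => k / 2 * C1 ^ 3 * (x + x0);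
       coef_r := fun x => (1 / 2 * C1 * (x + x0)) ^ 5;
       left_end := - x0 + 2 * sqrt (m / C1);
       right_end := - x0 + 2 * sqrt ((PI + m) / C1);
       delta0 := (C1 * m) ^ 2;
       delta1 := 0;
       gamma0 := C1 ^ 2 * (PI + m) ^ 2;
       gamma1 := 0 |} in
  exists X : R -> R,
    liouville_transformation (fun t => k / (t + m) ^ 2) P X /\
    reciprocal_linear (fun t => liouville_w P (X t)) /\
    boundary_normalized P.
Proof.
intros P.
(* The branch [x + x0 > 0] of the substitution, with inverse [T]. It integrates
   [dx/dt = sqrt (p/r) = 2 / (C1 * (x + x0))] with [X 0] at the left end. *)
set (X := fun t => - x0 + 2 * sqrt ((t + m) / C1)).
set (T := fun x => C1 / 4 * (x + x0) ^ 2 - m).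
assert (Pp : forall x, coef_p P x = 1 / 8 * C1 ^ 3 * (x + x0) ^ 3) by reflexivity.
assert (Pq : forall x, coef_q P x = k / 2 * C1 ^ 3 * (x + x0)) by reflexivity.
assert (Pr : forall x, coef_r P x = (1 / 2 * C1 * (x + x0)) ^ 5) by reflexivity.
assert (Hpi := PI_RGT_0).
assert (Tm : forall x, T x + m = C1 / 4 * (x + x0) ^ 2) by (intro; unfold T; ring).
assert (Spos : forall t, 0 <= t -> 0 < sqrt ((t + m) / C1)).
{ intros t Ht; apply sqrt_lt_R0, Rdiv_lt_0_compat; lra. }
assert (Ssq : forall t, 0 <= t -> C1 * (sqrt ((t + m) / C1)) ^ 2 = t + m).
{ intros t Ht; rewrite pow2_sqrt; [field; lra | ].
  apply Rlt_le, Rdiv_lt_0_compat; lra. }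
assert (Xs : forall t, X t + x0 = 2 * sqrt ((t + m) / C1)) by (intro; unfold X; ring).
assert (X0 : X 0 = left_end P) by (unfold X; simpl; rewrite Rplus_0_l; reflexivity).
assert (XPI : X PI = right_end P) by reflexivity.
assert (TX : forall t, 0 <= t -> T (X t) = t).
{ intros t Ht; unfold T; rewrite Xs.
  replace (C1 / 4 * _) with (C1 * (sqrt ((t + m) / C1)) ^ 2) by field.
  rewrite Ssq by exact Ht; ring. }
assert (XT : forall x, 0 < x + x0 -> X (T x) = x).
{ intros x Hx; unfold X, T.
  replace ((C1 / 4 * (x + x0) ^ 2 - m + m) / C1) with (((x + x0) / 2) ^ 2) by (field; lra).
  rewrite sqrt_pow2 by lra; field. }
assert (Xinc : forall s t, 0 <= s -> s < t -> X s < X t).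
{ intros s t Hs Hst; unfold X.
  apply Rplus_lt_compat_l, Rmult_lt_compat_l; [lra | ].
  apply sqrt_lt_1.
  - apply Rlt_le, Rdiv_lt_0_compat; lra.
  - apply Rlt_le, Rdiv_lt_0_compat; lra.
  - apply Rmult_lt_compat_r; [apply Rinv_0_lt_compat | ]; lra. }
assert (Hends : left_end P < right_end P) by (rewrite <- X0, <- XPI; apply Xinc; lra).
(* As [m > 0], the interval lies strictly to the right of [- x0], where the coefficients degenerate.
   Positivity of [p] and [r] and the choice of the square root branch rest on this. *)
assert (Ypos : forall x, left_end P <= x -> 0 < x + x0).
{ intros x Hx; rewrite <- X0 in Hx; specialize (Xs 0).
  specialize (Spos 0 (Rle_refl 0)); lra. }
assert (Tinc : forall x y, 0 < x + x0 -> x < y -> T x < T y).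
{ intros x y Hx Hxy; unfold T.
  apply Rplus_lt_compat_r, Rmult_lt_compat_l; [lra | nra]. }
assert (Tl : T (left_end P) = 0) by (rewrite <- X0; apply TX; lra).
assert (Tr : T (right_end P) = PI) by (rewrite <- XPI; apply TX; lra).
assert (DX : forall t, 0 <= t -> is_derive X t (2 / (C1 * (X t + x0)))).
{ intros t Ht; rewrite Xs; unfold X; auto_derive.
  - apply Rdiv_lt_0_compat; lra.
  - assert (Hs := Spos t Ht); unfold Rdiv in *; field; lra. }
assert (DT : forall x, is_derive T x (C1 / 2 * (x + x0))).
{ intros x; unfold T; auto_derive; [exact I | field]. }
assert (Wx : forall x, 0 < x + x0 -> liouville_w P x = / (C1 * (T x + m))).
{ intros x Hx; unfold liouville_w; rewrite Pp, Pr.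
  replace (_ * _) with ((C1 * (T x + m)) ^ 4) by (rewrite Tm; field).
  apply Rpower_pow4_neg_quarter; rewrite Tm.
  repeat apply Rmult_lt_0_compat; try apply pow_lt; lra. }
assert (Wt : forall t, 0 <= t -> liouville_w P (X t) = / (C1 * (t + m))).
{ intros t Ht; rewrite Wx, TX; [reflexivity | exact Ht | ].
  rewrite Xs; specialize (Spos t Ht); lra. }
(* The formula for [w] is known only for [t >= 0]; differentiating [1/w] requires it on a
   neighbourhood. *)
assert (iWloc : forall t, 0 < t ->
  locally t (fun s => C1 * (s + m) = / liouville_w P (X s))).
{ intros t Ht; generalize (open_gt 0 t Ht); apply filter_imp.
  intros s Hs; rewrite Wt by lra; rewrite Rinv_inv; reflexivity. }
assert (diWlin : forall t, is_derive (fun s => C1 * (s + m)) t C1).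
{ intros t; auto_derive; [exact I | ring]. }
assert (YT : forall t, 0 <= t -> 0 < X t + x0 /\ t + m = C1 / 4 * (X t + x0) ^ 2).
{ intros t Ht; split; [rewrite Xs; specialize (Spos t Ht); lra | ].
  assert (H := TX t Ht); unfold T in H; lra. }
exists X; split; [ | split].
- split; [exact Hends | ].
  split.
  { intros x [Hx _]; apply Ypos in Hx; rewrite Pp, Pr.
    assert (0 < C1 * (x + x0)) by (apply Rmult_lt_0_compat; lra).
    split.
    - replace (1 / 8 * C1 ^ 3 * (x + x0) ^ 3) with ((C1 * (x + x0) / 2) ^ 3) by field.
      apply pow_lt; lra.
    - apply pow_lt; lra. }
  split.
  { split; [ | split].
    - intros t [H1 H2]; rewrite <- X0, <- XPI; split.
      + destruct H1 as [H1 | <-]; [apply Rlt_le, Xinc; lra | lra].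
      + destruct H2 as [H2 | ->]; [apply Rlt_le, Xinc; lra | lra].
    - intros s t Hs Hst _; apply Xinc; assumption.
    - intros x [H1 H2]; exists (T x); split; [ | apply XT, Ypos, H1].
      rewrite <- Tl, <- Tr; assert (Hx := Ypos x H1); split.
      + destruct H1 as [H1 | <-]; [apply Rlt_le, Tinc; [apply Ypos, Rle_refl | exact H1] | lra].
      + destruct H2 as [H2 | ->]; [apply Rlt_le, Tinc; assumption | lra]. }
  split.
  { intros t Ht.
    assert (Hs : 0 < X t + x0) by (rewrite Xs; specialize (Spos t); lra).
    rewrite Pp, Pr.
    (* Here [p/r] is a perfect square, so its root is exactly the derivative in [DX]. *)
    replace (_ / _ ^ 5) with ((2 / (C1 * (X t + x0))) ^ 2) by (field; lra).
    rewrite sqrt_pow2; [apply DX; lra | ].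
    apply Rlt_le, Rdiv_lt_0_compat; [lra | apply Rmult_lt_0_compat; lra]. }
  split.
  { intros t Ht; cbv zeta beta.
    (* The first derivative of [1/w] is the constant [C1] near [t], not just at [t], so the second
       derivative is 0. *)
    assert (D2loc : locally t (fun s => C1 = Derive (fun s => / liouville_w P (X s)) s)).
    { generalize (open_gt 0 t (proj1 Ht)); apply filter_imp.
      intros s Hs; symmetry; apply is_derive_unique.
      apply is_derive_ext_loc with (1 := iWloc s Hs), diWlin. }
    assert (D2 : is_derive (Derive (fun s => / liouville_w P (X s))) t 0).
    { apply is_derive_ext_loc with (1 := D2loc).
      apply (is_derive_const (K := R_AbsRing) (V := R_NormedModule)). }
    split; [ | split].
    - exists C1; apply is_derive_ext_loc with (1 := iWloc t (proj1 Ht)), diWlin.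
    - exists 0; exact D2.
    - change (Derive_n (fun s => / liouville_w P (X s)) 2 t)
        with (Derive (Derive (fun s => / liouville_w P (X s))) t).
      rewrite (is_derive_unique _ _ _ D2).
      (* What remains is [k / (t + m)^2 = q/r], an identity in [X t + x0] once [t + m] is expressed
         through it. *)
      destruct (YT t (Rlt_le _ _ (proj1 Ht))) as [Hy Ey].
      rewrite Pq, Pr, Ey; field; lra. }
  intros lambda u v Huv.
  split.
  (* With [y = x + x0], the multiplier is [g = w = 4 / (C1^2 y^2)]. Then [alpha = p * g * T' = 1/w]
     and [beta = p * g' = - C1] are forced. *)
  + apply (dirichlet_solution_transfer (normal_form (fun t => k / (t + m) ^ 2)) P
      T (fun x => C1 / 2 * (x + x0))
      (fun x => 4 / (C1 ^ 2 * (x + x0) ^ 2)) (fun x => - 8 / (C1 ^ 2 * (x + x0) ^ 3))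
      (fun x => C1 ^ 2 / 4 * (x + x0) ^ 2) (fun x => C1 ^ 2 / 2 * (x + x0))
      (fun _ => - C1) (fun _ => 0)); try exact Hends; try exact Tl; try exact Tr;
      try reflexivity; try (simpl; lra); try (intros x [Hx Hx']; assert (Hy := Ypos x Hx)).
    * intros x [Hx Hx']; simpl; rewrite <- Tl, <- Tr; split; apply Tinc; try assumption;
        apply Ypos; lra.
    * apply DT.
    * auto_derive; [ | field; lra].
      apply Rgt_not_eq, Rmult_lt_0_compat; [apply (pow_lt C1 2) | apply (pow_lt (x + x0) 2)]; assumption.
    * auto_derive; [exact I | field].
    * auto_derive; [exact I | reflexivity].
    * simpl; field; lra.
    * simpl; field; lra.
    * simpl; field.
    * rewrite Pq; unfold normal_form; cbn [coef_q]; rewrite Tm; field; lra.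
    * simpl; field; lra.
    * assert (HT : 0 <= T x <= PI).
      { rewrite <- Tl, <- Tr; split.
        - destruct Hx as [Hx | <-]; [apply Rlt_le, Tinc; [apply Ypos, Rle_refl | exact Hx] | lra].
        - destruct Hx' as [Hx' | ->]; [apply Rlt_le, Tinc; assumption | lra]. }
      (* The point is written as [X (T x)], since [Huv] relates [u] and [v] only along [X]. *)
      rewrite <- (XT x Hy) at 1; rewrite (Huv _ HT), Wt by lra.
      rewrite Tm; f_equal; field; lra.
  + assert (HP0 : delta0 P <> 0).
    { apply Rgt_not_eq, pow_lt, Rmult_lt_0_compat; lra. }
    assert (HP1 : gamma0 P <> 0).
    { apply Rgt_not_eq, Rmult_lt_0_compat; apply pow_lt; lra. }
    (* The inverse substitution: [u] and [v] exchange roles and the multiplier is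
       [1/w = C1 * (t + m)]. Now [alpha = w], and [beta] is the slope [C1] of [1/w]. *)
    apply (dirichlet_solution_transfer P (normal_form (fun t => k / (t + m) ^ 2))
      X (fun t => 2 / (C1 * (X t + x0)))
      (fun t => C1 * (t + m)) (fun _ => C1)
      (fun t => / (C1 * (t + m))) (fun t => - / (C1 * (t + m) ^ 2))
      (fun _ => C1) (fun _ => 0)); try exact Hends; try exact X0; try exact XPI;
      try assumption; try reflexivity; try (intros t [Ht Ht']; simpl in Ht, Ht'; destruct (YT t Ht) as [Hy Ey]).
    * intros t [Ht Ht']; simpl in Ht, Ht'; rewrite <- X0, <- XPI; split; apply Xinc; lra.
    * apply DX, Ht.
    * apply diWlin.
    * auto_derive; [ | field; lra].
      apply Rgt_not_eq, Rmult_lt_0_compat; lra.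
    * auto_derive; [exact I | reflexivity].
    * rewrite Pp, Ey; unfold normal_form; cbn [coef_p]; rewrite ?Ey; field; lra.
    * simpl; ring.
    * rewrite Pp, Ey; unfold normal_form; cbn [coef_p]; rewrite ?Ey; field; lra.
    * rewrite Pq, Ey; unfold normal_form; cbn [coef_q]; rewrite ?Ey; field; lra.
    * rewrite Pr, Ey; unfold normal_form; cbn [coef_r]; rewrite ?Ey; field; lra.
    * rewrite (Huv t (conj Ht Ht')), Wt by exact Ht; field; lra.
- exists C1, (C1 * m); split; [lra | ].
  intros t [Ht _]; rewrite Wt by exact Ht; field; lra.
- split.
  (* Viewing the endpoint as [X 0] gives [1/w = C1 * m] there; its square is [delta0]. The right end
     is [X PI], with [1/w = C1 * (PI + m)]. *)
  + rewrite <- X0 at 1; rewrite Wt by lra; simpl; field; lra.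
  + rewrite <- XPI at 1; rewrite Wt by lra; simpl; field; lra.
Qed.
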